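(* Let $\nu$ be a Borel probability measure on $M$ and let $v\in S(\mathfrak{k})$. Let $c_0<\cdots<c_r$ be the critical values of $\mu^v$, let $C_i:=(\mu^v)^{-1}(c_i)$, and let $$W^u_i:=\Big\{x\in M:\ \lim_{t\to+\infty}\exp(itv)\cdot x\in C_i\Big\}.$$ Then $$\lambda_\nu(\mathrm{e}(-v))=\sum_{i=0}^r c_i\cdot\nu(W^u_i).$$
   Context: Setting. $(M,J,\omega)$ is a compact Kähler manifold with Riemannian metric $g_M$, $\omega(X,Y)=g_M(JX,Y)$. $K$ is a compact connected Lie group with Lie algebra $\mathfrak{k}$ acting on $M$ almost effectively (i.e. $v_M=0$ implies $v=0$ for $v\in\mathfrak{k}$, $v_M$ the fundamental vector field) and by holomorphic isometries. The action is Hamiltonian with momentum mapping $\mu:M\to\mathfrak{k}^*$: $\mu$ is $K$-equivariant and $d\mu^v=i_{v_M}\omega$, where $\mu^v=\langle\mu,v\rangle$. The action extends to a holomorphic action of $G=K^{\mathbb C}$ with $(iv)_M=Jv_M=\operatorname{grad}\mu^v$ for $v \in \mathfrak{k}$. For every $x\in M$ and $v\in\mathfrak{k}$ the limit $\lim_{t\to+\infty}\exp(itv)\cdot x$ exists. $S(\mathfrak{k})$ is the unit sphere for a fixed $\operatorname{Ad}$-invariant scalar product on $\mathfrak{k}$, and $X=G/K$ carries the corresponding $G$-invariant Riemannian metric. Kempf-Ness function. There is a function $\Psi^M:M\times G\to\mathbb{R}$, smooth in $g\in G$, with $\Psi^M(x,kg)=\Psi^M(x,g)$ for $k\in K$,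 $\Psi^M(x,g)+\Psi^M(gx,h)=\Psi^M(x,hg)$, $\frac{d^2}{dt^2}\Psi^M(x,\exp(itv))\geq 0$ for $v \in \mathfrak{k}$ (with equality at $t=0$ iff $\exp(\mathbb{C}v)$ fixes $x$), and $\frac{d}{dt}|_{t=0}\Psi^M(x,\exp(itv))=\mu^v(x)$ for $v\in\mathfrak{k}$. For a Borel probability measure $\nu$ on $M$ put $\Psi^{\mathscr{P}}(\nu,g)=\int_M\Psi^M(x,g)\,d\nu(x)$ and $\psi^{\mathscr{P}}_\nu(gK)=\Psi^{\mathscr{P}}(\nu,g^{-1})$, a convex Lipschitz function on $X$. Maximal weight. The Tits boundary $\partial_\infty X$ is the set of equivalence classes of unit speed geodesics of $X$, where $\gamma\sim\gamma'$ iff $\sup_{t>0}d(\gamma(t),\gamma'(t))<\infty$; for $v\in S(\mathfrak{k})$, $\mathrm{e}(v)\in\partial_\infty X$ is the class of $t\mapsto\exp(itv)K$. The maximal weight of $\nu$ is $\lambda_\nu:\partial_\infty X\to\mathbb{R}$, $\lambda_\nu([\gamma])=\lim_{t\to+\infty}\frac{d}{dt}\psi^{\mathscr{P}}_\nu(\gamma(t))$; in particular $\lambda_\nu(\mathrm{e}(-v))=\lim_{t\to+\infty}\frac{d}{dt}\Psi^{\mathscr{P}}(\nu,\exp(itv))$. *)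

(* Defs.v *)
From HB Require Import structures.
From mathcomp Require Import all_boot all_order all_algebra.
From mathcomp Require Import all_classical all_reals all_analysis.
Set Implicit Arguments.
Unset Strict Implicit.
Unset Printing Implicit Defensive.
Import Order.TTheory GRing.Theory Num.Theory.
Import numFieldNormedType.Exports.
Local Open Scope classical_set_scope.
Local Open Scope ring_scope.

(** * Smooth manifolds *)

(* [Ck k U f] is meant for [U] open and finite-dimensional [V]. *)
Fixpoint Ck (R : realType) (V W : normedModType R) (k : nat)
    (U : set V) (f : V -> W) : Prop :=
  match k with
  | 0%N => forall x, U x -> {for x, continuous f}
  | k'.+1 => (forall x, U x -> differentiable f x) /\
             (forall v, Ck k' U (fun x => 'd f x v))
  end.

Definition smooth_on (R : realType) (V W : normedModType R)
    (U : set V) (f : V -> W) : Prop := forall k, Ck k U f.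

Record chart (R : realType) (n : nat) (T : topologicalType) := Chart {
  cdom : set T;
  cmap :> T -> 'rV[R]_n;
  cinv : 'rV[R]_n -> T;
  cdom_open : open cdom;
  cimg_open : open (cmap @` cdom);
  cmapK : forall x, cdom x -> cinv (cmap x) = x;
  cmap_continuous : forall x, cdom x -> {for x, continuous cmap};
  cinv_continuous : forall y, (cmap @` cdom) y -> {for y, continuous cinv} }.

Definition cimg (R : realType) n (T : topologicalType) (c : chart R n T) :
  set 'rV[R]_n := c @` cdom c.

Definition smooth_transition (R : realType) n (T : topologicalType)
    (c c' : chart R n T) : Prop :=
  smooth_on (c @` (cdom c `&` cdom c')) (c' \o cinv c).

(* The atlas is [range chart_at].  The tangent space at [p] is identified with
   ['rV[R]_n] by means of the distinguished chart [chart_at p]: all tangent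
   vectors at [p] below are given by their coordinates in that chart. *)
Record manifold (R : realType) (n : nat) := Manifold {
  mcarrier :> ptopologicalType;
  chart_at : mcarrier -> chart R n mcarrier;
  mem_chart_at : forall p, cdom (chart_at p) p;
  smooth_atlas : forall p q, smooth_transition (chart_at p) (chart_at q);
  manifold_hausdorff : hausdorff_space mcarrier;
  manifold_second_countable : @second_countable mcarrier }.

Arguments chart_at {R n m} p.

Section Maps.
Context {R : realType} {m n k : nat}.
Variables (M : manifold R m) (N : manifold R n) (P : manifold R k).

Definition smooth_map (f : M -> N) : Prop :=
  continuous f /\
  forall p q, smooth_on
    (chart_at p @` (cdom (chart_at p) `&` f @^-1` cdom (chart_at q)))
    (chart_at q \o f \o cinv (chart_at p)).

(* joint smoothness, on the product manifold [M * N] *)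
Definition smooth_map2 (f : M -> N -> P) : Prop :=
  continuous (fun z : M * N => f z.1 z.2) /\
  forall p q r, smooth_on
    [set y | exists a b, [/\ cdom (chart_at p) a, cdom (chart_at q) b,
       cdom (chart_at r) (f a b) & y = (chart_at p a, chart_at q b)]]
    (fun y : 'rV[R]_m * 'rV[R]_n =>
       chart_at r (f (cinv (chart_at p) y.1) (cinv (chart_at q) y.2))).

Definition smooth_fun (f : M -> R) : Prop :=
  forall p, smooth_on (cimg (chart_at p)) (f \o cinv (chart_at p)).

Definition smooth_curve (g : R -> M) : Prop :=
  continuous g /\
  forall q, smooth_on (g @^-1` cdom (chart_at q)) (chart_at q \o g).

Definition tmap (f : M -> N) (p : M) (X : 'rV[R]_m) : 'rV[R]_n :=
  'd (chart_at (f p) \o f \o cinv (chart_at p)) (chart_at p p) X.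

Definition dfun (f : M -> R) (p : M) (X : 'rV[R]_m) : R :=
  'd (f \o cinv (chart_at p)) (chart_at p p) X.

Definition critical_value (f : M -> R) (a : R) : Prop :=
  exists2 p, (forall X, dfun f p X = 0) & f p = a.

Definition velocity (g : R -> M) (t : R) : 'rV[R]_m :=
  derive1 (chart_at (g t) \o g) t.

(* at [x], the tangent vector whose coordinates in [chart_at p] are [u] *)
Definition coord_vector (p : M) (u : 'rV[R]_m) (x : M) : 'rV[R]_m :=
  'd (chart_at x \o cinv (chart_at p)) (chart_at p x) u.

(* coordinate expression in [chart_at p] of a covariant 2-tensor field *)
Definition coord2 (h : M -> 'rV[R]_m -> 'rV[R]_m -> R) (p : M)
    (u v : 'rV[R]_m) (y : 'rV[R]_m) : R :=
  let x := cinv (chart_at p) y in h x (coord_vector p u x) (coord_vector p v x).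

Definition smooth_tensor2 (h : M -> 'rV[R]_m -> 'rV[R]_m -> R) : Prop :=
  forall p u v, smooth_on (cimg (chart_at p)) (coord2 h p u v).

Definition closed_form2 (w : M -> 'rV[R]_m -> 'rV[R]_m -> R) : Prop :=
  forall p u v z y, cimg (chart_at p) y ->
    'd (coord2 w p v z) y u + 'd (coord2 w p z u) y v + 'd (coord2 w p u v) y z
    = 0.

End Maps.

(** * Riemannian and Kaehler structures *)

Record inner_product (R : realType) n (b : 'rV[R]_n -> 'rV[R]_n -> R) : Prop :=
  InnerProduct {
  ip_linear : forall a x y z, b (a *: x + y) z = a * b x z + b y z;
  ip_sym : forall x y, b x y = b y x;
  ip_pos : forall x, x != 0 -> 0 < b x x }.

Lemma unit_opp (R : realType) n (b : 'rV[R]_n -> 'rV[R]_n -> R) v :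
  inner_product b -> b v v = 1 -> b (- v) (- v) = 1.
Proof.
move=> [lin sym _] b1.
have b0 z : b 0 z = 0.
  by have /eqP := lin 1 0 0 z; rewrite scale1r addr0 mul1r -subr_eq subrr => /eqP.
have bN x z : b (- x) z = - b x z.
  by have := lin (-1) x 0 z; rewrite scaleN1r addr0 b0 addr0 mulN1r.
by rewrite bN sym bN opprK.
Qed.

Section Riemannian.
Context {R : realType} {n : nat} (M : manifold R n).
Variable h : M -> 'rV[R]_n -> 'rV[R]_n -> R.

Definition riemannian_metric : Prop :=
  (forall p, inner_product (h p)) /\ smooth_tensor2 h.

Definition curve_length (g : R -> M) : R :=
  \int[lebesgue_measure]_(t in `[0%R, 1%R])
    Num.sqrt (h (g t) (velocity g t) (velocity g t)).

Definition riemannian_dist (p q : M) : R :=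
  inf [set L | exists g : R -> M,
         [/\ smooth_curve g, g 0 = p, g 1 = q & L = curve_length g]].

(* Christoffel symbols of the first kind of the Levi-Civita connection: the
   product with [w] of the covariant derivative of [v] along [u], where
   [u], [v], [w] are constant in [chart_at p] *)
Definition christoffel (p : M) (u v w y : 'rV[R]_n) : R :=
  2^-1 * ('d (coord2 h p v w) y u + 'd (coord2 h p u w) y v
          - 'd (coord2 h p u v) y w).

(* The geodesic equation of the Levi-Civita connection in coordinates, paired
   with an arbitrary vector [w]. *)
Definition geodesic (g : R -> M) : Prop :=
  smooth_curve g /\
  forall q t w, cdom (chart_at q) (g t) ->
    let c := chart_at q \o g in
    coord2 h q (derive1 (derive1 c) t) w (c t)
    + christoffel q (derive1 c t) (derive1 c t) w (c t) = 0.

Definition unit_speed_geodesic (g : R -> M) : Prop :=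
  geodesic g /\ forall t, h (g t) (velocity g t) (velocity g t) = 1.

Definition asymptotic (g g' : R -> M) : Prop :=
  exists C, forall t, 0 < t -> riemannian_dist (g t) (g' t) <= C.

Definition asymptote_class (g : R -> M) : set (R -> M) :=
  [set g' | unit_speed_geodesic g' /\ asymptotic g g'].

Definition tits_boundary : set (set (R -> M)) :=
  asymptote_class @` unit_speed_geodesic.

Definition boundary_class (g : R -> M) (Hg : unit_speed_geodesic g) :
    tits_boundary :=
  SigSub (mem_set (imageP asymptote_class Hg)).

End Riemannian.

(* An almost complex structure that is constant in suitable smooth charts. *)
Record complex_structure (R : realType) n (M : manifold R n)
    (J : M -> 'rV[R]_n -> 'rV[R]_n) : Prop := ComplexStructure {
  cs_linear : forall p a X Y, J p (a *: X + Y) = a *: J p X + J p Y;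
  cs_square : forall p X, J p (J p X) = - X;
  cs_integrable : forall p, exists (c : chart R n M)
      (J0 : 'rV[R]_n -> 'rV[R]_n),
    [/\ cdom c p,
        forall q, smooth_transition c (chart_at q) /\
                  smooth_transition (chart_at q) c &
        forall x X, cdom c x ->
          let dc := 'd (c \o cinv (chart_at x)) (chart_at x x) in
          dc (J x X) = J0 (dc X)] }.

Definition holomorphic (R : realType) m n (M : manifold R m) (N : manifold R n)
    (JM : M -> 'rV[R]_m -> 'rV[R]_m) (JN : N -> 'rV[R]_n -> 'rV[R]_n)
    (f : M -> N) : Prop :=
  smooth_map f /\ forall p X, tmap f p (JM p X) = JN (f p) (tmap f p X).

Definition kahler_form (R : realType) n (M : manifold R n)
    (J : M -> 'rV[R]_n -> 'rV[R]_n) (h : M -> 'rV[R]_n -> 'rV[R]_n -> R) :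
  M -> 'rV[R]_n -> 'rV[R]_n -> R := fun p X Y => h p (J p X) Y.

Record kahler (R : realType) n (M : manifold R n)
    (J : M -> 'rV[R]_n -> 'rV[R]_n) (h : M -> 'rV[R]_n -> 'rV[R]_n -> R) : Prop :=
  Kahler {
  kahler_complex : complex_structure J;
  kahler_metric : riemannian_metric h;
  kahler_hermitian : forall p X Y, h p (J p X) (J p Y) = h p X Y;
  kahler_closed : closed_form2 (kahler_form J h) }.

(** * Lie groups and their actions *)

(* The Lie algebra is the tangent space at [lg_one]. *)
Record lie_group (R : realType) (n : nat) := LieGroup {
  lg_manifold :> manifold R n;
  lg_mul : lg_manifold -> lg_manifold -> lg_manifold;
  lg_one : lg_manifold;
  lg_inv : lg_manifold -> lg_manifold;
  lg_mulA : forall x y z, lg_mul x (lg_mul y z) = lg_mul (lg_mul x y) z;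
  lg_mul1 : forall x, lg_mul lg_one x = x;
  lg_mulV : forall x, lg_mul (lg_inv x) x = lg_one;
  lg_mul_smooth : smooth_map2 lg_mul;
  lg_inv_smooth : smooth_map lg_inv }.

Arguments lg_one {R n}.

Record complex_lie_group (R : realType) (n : nat) := ComplexLieGroup {
  clg_group :> lie_group R n;
  clg_J : clg_group -> 'rV[R]_n -> 'rV[R]_n;
  clg_complex : complex_structure clg_J;
  clg_mul_holo_r : forall x, holomorphic clg_J clg_J (lg_mul x);
  clg_mul_holo_l : forall x, holomorphic clg_J clg_J (fun y => lg_mul y x);
  clg_inv_holo : holomorphic clg_J clg_J (@lg_inv R n clg_group) }.

Definition lie_hom (R : realType) m n (G : lie_group R m) (H : lie_group R n)
    (f : G -> H) : Prop :=
  smooth_map f /\ forall x y, f (lg_mul x y) = lg_mul (f x) (f y).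

(* characterizes the exponential map: [t |-> e (t v)] is the one-parameter
   subgroup with initial velocity [v] *)
Definition exponential (R : realType) n (G : lie_group R n)
    (e : 'rV[R]_n -> G) : Prop :=
  forall v, [/\ smooth_curve (fun t => e (t *: v)),
    forall s t, e ((s + t) *: v) = lg_mul (e (s *: v)) (e (t *: v)) &
    velocity (fun t => e (t *: v)) 0 = v].

Definition Ad (R : realType) n (G : lie_group R n) (g : G) (v : 'rV[R]_n) :
    'rV[R]_n :=
  tmap (fun h => lg_mul (lg_mul g h) (lg_inv g)) (lg_one G) v.

(* the universal complexification of a Lie group *)
Definition complexification (R : realType) k d (K : lie_group R k)
    (G : complex_lie_group R d) (iota : K -> G) : Prop :=
  lie_hom iota /\
  forall n (H : complex_lie_group R n) (f : K -> H), lie_hom f ->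
    exists2 F : G -> H,
      [/\ lie_hom F, holomorphic (@clg_J R d G) (@clg_J R n H) F &
          forall x, F (iota x) = f x] &
      forall F' : G -> H,
        lie_hom F' -> holomorphic (@clg_J R d G) (@clg_J R n H) F' ->
        (forall x, F' (iota x) = f x) -> F' =1 F.

(* [i v], in the Lie algebra of the complexification *)
Definition itimes (R : realType) k d (K : lie_group R k)
    (G : complex_lie_group R d) (iota : K -> G) (v : 'rV[R]_k) : 'rV[R]_d :=
  clg_J (lg_one G) (tmap iota (lg_one K) v).

Definition smooth_action (R : realType) k n (G : lie_group R k)
    (M : manifold R n) (a : G -> M -> M) : Prop :=
  [/\ smooth_map2 a, forall x, a (lg_one G) x = x &
      forall g h x, a (lg_mul g h) x = a g (a h x)].

(* the value at [x] of the fundamental vector field of [v] *)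
Definition fundamental (R : realType) k n (G : lie_group R k)
    (M : manifold R n) (a : G -> M -> M) (v : 'rV[R]_k) (x : M) : 'rV[R]_n :=
  tmap (fun g => a g x) (lg_one G) v.

Definition isometric (R : realType) n (M : manifold R n)
    (h : M -> 'rV[R]_n -> 'rV[R]_n -> R) (f : M -> M) : Prop :=
  forall p X Y, h (f p) (tmap f p X) (tmap f p Y) = h p X Y.

(** * Hamiltonian actions *)

Record momentum_map (R : realType) n k (M : manifold R n)
    (J : M -> 'rV[R]_n -> 'rV[R]_n) (h : M -> 'rV[R]_n -> 'rV[R]_n -> R)
    (K : lie_group R k) (a : K -> M -> M)
    (mu : M -> {scalar 'rV[R]_k}) : Prop := MomentumMap {
  mm_smooth : forall v, smooth_fun (fun x => mu x v);
  mm_equivariant : forall g x v, mu (a g x) v = mu x (Ad (lg_inv g) v);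
  mm_diff : forall v x X,
    dfun (fun x => mu x v) x X = kahler_form J h x (fundamental a v x) X }.

Record hamiltonian_action (R : realType) n k (M : manifold R n)
    (J : M -> 'rV[R]_n -> 'rV[R]_n) (h : M -> 'rV[R]_n -> 'rV[R]_n -> R)
    (K : lie_group R k) (a : K -> M -> M)
    (mu : M -> {scalar 'rV[R]_k}) : Prop := HamiltonianAction {
  ha_action : smooth_action a;
  ha_effective : forall v, (forall x, fundamental a v x = 0) -> v = 0;
  ha_holomorphic : forall g, holomorphic J J (a g);
  ha_isometric : forall g, isometric h (a g);
  ha_momentum : momentum_map J h a mu }.

Record complexified_action (R : realType) n k d (M : manifold R n)
    (J : M -> 'rV[R]_n -> 'rV[R]_n)
    (K : lie_group R k) (aK : K -> M -> M)
    (G : complex_lie_group R d) (iota : K -> G) (aG : G -> M -> M) : Prop :=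
  ComplexifiedAction {
  ca_action : smooth_action aG;
  ca_holomorphic_l : forall x, holomorphic (@clg_J R d G) J (fun g => aG g x);
  ca_holomorphic_r : forall g, holomorphic J J (aG g);
  ca_extends : forall g x, aG (iota g) x = aK g x;
  ca_fundamental : forall v x,
    fundamental aG (itimes iota v) x = J x (fundamental aK v x) }.

(** * The symmetric space [G / K] *)

(* [X], with projection [pi] and action [aX], is the quotient manifold [G / K];
   [gX] is the [G]-invariant metric given at the base point by
   [<i v, i w> = sp v w]. *)
Record symmetric_space (R : realType) k d l (K : lie_group R k)
    (G : complex_lie_group R d) (iota : K -> G)
    (sp : 'rV[R]_k -> 'rV[R]_k -> R)
    (X : manifold R l) (pi : G -> X) (aX : G -> X -> X)
    (gX : X -> 'rV[R]_l -> 'rV[R]_l -> R) : Prop := SymmetricSpace {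
  ss_smooth : smooth_map pi;
  ss_surjective : forall x, exists g, pi g = x;
  ss_fiber : forall g h, pi g = pi h <-> exists z, h = lg_mul g (iota z);
  ss_submersion : forall g Y, exists Z, tmap pi g Z = Y;
  ss_action : smooth_action aX;
  ss_equivariant : forall g h, aX g (pi h) = pi (lg_mul g h);
  ss_metric : riemannian_metric gX;
  ss_invariant : forall g, isometric gX (aX g);
  ss_base : forall v w,
    gX (pi (lg_one G)) (tmap pi (lg_one G) (itimes iota v))
                       (tmap pi (lg_one G) (itimes iota w)) = sp v w }.

(** * Kempf-Ness functions and maximal weights *)

Record kempf_ness (R : realType) n k d (M : manifold R n)
    (K : lie_group R k) (G : complex_lie_group R d) (iota : K -> G)
    (expG : 'rV[R]_d -> G) (aG : G -> M -> M)
    (mu : M -> {scalar 'rV[R]_k}) (Psi : M -> G -> R) : Prop := KempfNess {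
  kn_smooth : forall x, smooth_fun (Psi x);
  kn_invariant : forall x z g, Psi x (lg_mul (iota z) g) = Psi x g;
  kn_cocycle : forall x g h, Psi x g + Psi (aG g x) h = Psi x (lg_mul h g);
  kn_convex : forall x v t,
    0 <= derive1n 2 (fun t : R => Psi x (expG (t *: itimes iota v))) t;
  kn_convex_eq : forall x v,
    derive1n 2 (fun t : R => Psi x (expG (t *: itimes iota v))) 0 = 0 <->
    forall a b : R,
      aG (expG (a *: tmap iota (lg_one K) v + b *: itimes iota v)) x = x;
  kn_derive : forall x v,
    derive1 (fun t : R => Psi x (expG (t *: itimes iota v))) 0 = mu x v }.

Notation borel M := (g_sigma_algebraType (@open M)).

Definition PsiP (R : realType) n d (M : manifold R n) (G : lie_group R d)
    (Psi : M -> G -> R) (nu : probability (borel M) R) (g : G) : R :=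
  \int[nu]_x Psi x g.

(* [psiX (g K) = PsiP g^-1], computed on a chosen representative of the coset *)
Definition psiX (R : realType) n d l (M : manifold R n) (G : lie_group R d)
    (X : manifold R l) (pi : G -> X) (Psi : M -> G -> R)
    (nu : probability (borel M) R) (x : X) : R :=
  PsiP Psi nu (lg_inv (get [set g | pi g = x])).

Definition maximal_weight (R : realType) n d l (M : manifold R n)
    (G : lie_group R d) (X : manifold R l) (pi : G -> X)
    (gX : X -> 'rV[R]_l -> 'rV[R]_l -> R) (Psi : M -> G -> R)
    (nu : probability (borel M) R) (lam : tits_boundary gX -> R) : Prop :=
  forall g (Hg : unit_speed_geodesic gX g),
    derive1 (psiX pi Psi nu \o g) t @[t --> +oo] --> lam (boundary_class Hg).

(* the curve [t |-> exp (i t v) K] *)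
Definition ray (R : realType) k d l (K : lie_group R k)
    (G : complex_lie_group R d) (iota : K -> G) (expG : 'rV[R]_d -> G)
    (X : manifold R l) (pi : G -> X) (v : 'rV[R]_k) : R -> X :=
  fun t => pi (expG (t *: itimes iota v)).

(* Main.v *)
Require Import Defs.
From HB Require Import structures.
From mathcomp Require Import all_boot all_order all_algebra.
From mathcomp Require Import all_classical all_reals all_analysis.
From mathcomp Require Import measurable_realfun.
Set Implicit Arguments.
Unset Strict Implicit.
Unset Printing Implicit Defensive.
Import Order.TTheory GRing.Theory Num.Theory.
Import numFieldNormedType.Exports.
Local Open Scope classical_set_scope.
Local Open Scope ring_scope.

(** Write [phi t x = exp(itv) x] and [f t x = Psi(x, exp(itv))].  The cocycle
    identity turns the derivative of [f] at time [0] into the derivative at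
    every time: [d/dt f t x = mu^v (phi t x)] ([kempf_ness_is_derive]).  On the
    compact manifold this derivative is bounded uniformly in [t] and [x], so
    one may differentiate under the integral sign, and the slope at time [t]
    of the averaged Kempf-Ness function is the mean of [mu^v (phi t x)] over
    [nu].  As [t] grows, [mu^v (phi t x)] tends to [mu^v (y x)], where [y x] is
    the limit point of the trajectory of [x], and dominated convergence
    ([cvg_derive_integral]) identifies the maximal weight with the mean of
    [mu^v (y x)].

    The limit point [y x] is fixed by the flow, hence the fundamental field of
    [iv], which is the gradient of [mu^v], vanishes there and [mu^v (y x)] is a
    critical value ([flow_limit_critical]).  So [x |-> mu^v (y x)] takes finitely
    many values [c_i], the unstable sets [W^u_i] are its level sets, and its mean
    is the sum of the [c_i nu(W^u_i)] ([integral_finite_image]).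

    Two further points need an argument.  Smoothness of [Psi] is only given in
    the group variable; that [Psi(x, exp(itv))] is measurable in [x] follows from
    its being a primitive in [t] of a jointly continuous function
    ([primitive_continuous]).  And the function [psi] on [G/K] is computed on a
    chosen representative of each coset; invariance of [Psi] under [K] replaces
    it by any other ([psiX_coset]). *)

(** * Calculus in charts *)

Section Charts.
Context {R : realType} {m n : nat} (M : manifold R m) (N : manifold R n).

Lemma smooth_on_differentiable (V W : normedModType R) (U : set V)
  (f : V -> W) x : smooth_on U f -> U x -> differentiable f x.
Proof. by move=> /(_ 1%N)[df _]; exact: df. Qed.

Lemma near_chart (p : M) :
  \forall x \near p, cinv (chart_at p) (chart_at p x) = x.
Proof.
have : nbhs p (cdom (chart_at p)).
  by apply: open_nbhs_nbhs; split; [exact: cdom_open|exact: mem_chart_at].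
by apply: filterS => x; exact: cmapK.
Qed.

Lemma near_chart_curve (g : R -> M) (t : R) : continuous g ->
  \forall s \near t, cinv (chart_at (g t)) (chart_at (g t) (g s)) = g s.
Proof. by move=> cg; exact: (cg t _ (near_chart (g t))). Qed.

Lemma smooth_fun_chart (f : M -> R) (p : M) : smooth_fun f ->
  differentiable (f \o cinv (chart_at p)) (chart_at p p).
Proof.
move=> /(_ p) /smooth_on_differentiable; apply.
by exists p => //; exact: mem_chart_at.
Qed.

Lemma smooth_curve_chart (g : R -> M) (t : R) : smooth_curve g ->
  differentiable (chart_at (g t) \o g) t.
Proof.
move=> [_ /(_ (g t)) /smooth_on_differentiable]; apply.
exact: mem_chart_at.
Qed.

Lemma smooth_map_chart (f : M -> N) (p : M) : smooth_map f ->
  differentiable (chart_at (f p) \o f \o cinv (chart_at p)) (chart_at p p).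
Proof.
move=> [_ /(_ p (f p)) /smooth_on_differentiable]; apply.
by exists p => //; split; exact: mem_chart_at.
Qed.

Lemma smooth_fun_continuous (f : M -> R) : smooth_fun f -> continuous f.
Proof.
move=> sf p.
have cc : {for p, continuous (chart_at p)}.
  by apply: cmap_continuous; exact: mem_chart_at.
have cf := differentiable_continuous (smooth_fun_chart p sf).
have : f (cinv (chart_at p) (chart_at p x)) @[x --> p] -->
    f (cinv (chart_at p) (chart_at p p)) := continuous_comp cc cf.
rewrite cmapK; last exact: mem_chart_at.
apply: cvg_trans; apply: near_eq_cvg.
by apply: filterS (near_chart p) => x /= ->.
Qed.

Lemma smooth_fun_curve_derivable (f : M -> R) (g : R -> M) (t : R) :
  smooth_fun f -> smooth_curve g -> derivable (f \o g) t 1.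
Proof.
move=> sf sg; have [cg _] := sg.
have dc := smooth_curve_chart t sg.
have df := smooth_fun_chart (g t) sf.
apply: near_eq_derivable (diff_derivable (differentiable_comp dc df)).
rewrite /prop_near1 /prop_for /=.
by apply: (@filterS _ (nbhs t)) (near_chart_curve t cg) => s /= ->.
Qed.

(** Chain rule: near [t] the inverse chart at [g t] undoes the chart, so the
    coordinate expressions of [f] and [g] compose to that of [f \o g]. *)
Lemma velocity_comp (f : M -> N) (g : R -> M) (t : R) :
  smooth_map f -> smooth_curve g ->
  velocity (f \o g) t = tmap f (g t) (velocity g t).
Proof.
move=> sf sg; have [cg _] := sg.
have dc := smooth_curve_chart t sg.
have df := smooth_map_chart (g t) sf.
rewrite /velocity /tmap !derive1E [in RHS]deriveE//.
transitivity ('D_1 ((chart_at (f (g t)) \o f \o cinv (chart_at (g t))) \o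
   (chart_at (g t) \o g)) t); last first.
  by rewrite deriveE ?diff_comp//; exact: differentiable_comp.
apply: near_eq_derive.
rewrite /prop_near1 /prop_for /=.
by apply: (@filterS _ (nbhs t)) (near_chart_curve t cg) => s /= ->.
Qed.

End Charts.

(** * Integrals depending on a parameter *)

Section ParametricPrimitives.
Context {R : realType}.

Lemma primitive_norm_le (f m : R -> R) (t e : R) : 0 <= t ->
  (forall s : R, is_derive s 1 f (m s)) -> f 0 = 0 ->
  (forall s, 0 <= s <= t -> `|m s| <= e) -> `|f t| <= e * t.
Proof.
move=> t0 df f0 me.
have cf : {within `[0, t], continuous f}.
  apply: derivable_within_continuous => s _.
  by case: (df s).
have [s + E] := MVT_segment t0 (fun s _ => df s) cf.
rewrite in_itv /= => /me mse.
by move: E; rewrite f0 !subr0 => ->; rewrite normrM (ger0_norm t0) ler_wpM2r.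
Qed.

(** By compactness of [[0, t]] the functions [m s] have, near [x], a common
    modulus of continuity for all [s] in that segment; the mean value theorem
    applied to [f ^~ x - f ^~ y] carries it over to [f t]. *)
Lemma primitive_continuous (T : topologicalType) (f m : R -> T -> R) (t : R) :
  0 <= t -> (forall (s : R) x, is_derive s 1 (f ^~ x) (m s x)) ->
  (forall x, f 0 x = 0) -> continuous (fun z : R * T => m z.1 z.2) ->
  continuous (f t).
Proof.
move=> t0 df f0 cm x; apply/cvgrPdist_le => e e0.
have e'0 : 0 < e / (t + 1) by rewrite divr_gt0// ltr_wpDl.
have : \forall y \near x, `[0, t] `<=` (fun s => `|m s x - m s y| <= e / (t + 1)).
  have /compact_near_coveringP := @segment_compact R 0 t.
  move=> /(_ T (nbhs x) (fun y s => `|m s x - m s y| <= e / (t + 1))); apply.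
  move=> s _.
  have c1 : (fun z : R * T => m z.1 x - m z.1 z.2) z @[z --> (s, x)] --> m s x - m s x.
    apply: cvgB; last exact: (cm (s, x)).
    apply: (@cvg_comp _ _ _ (fun z : R * T => (z.1, x)) (fun z => m z.1 z.2) _
      (nbhs (s, x))); last exact: (cm (s, x)).
    exact: (cvg_pair cvg_fst (cvg_cst x)).
  rewrite subrr in c1; move/cvgr0Pnorm_le : c1 => /(_ _ e'0).
  exact.
apply: filterS => y my.
have dfy (s : R) : is_derive s 1 (fun s => f s x - f s y) (m s x - m s y).
  exact: is_deriveB.
have := @primitive_norm_le _ _ t (e / (t + 1)) t0 dfy.
rewrite !f0 subrr => /(_ erefl) h.
apply: (le_trans (h _)) => [s st|].
  by apply: my; rewrite /= in_itv.
by rewrite -mulrA ler_piMr ?(ltW e0)// mulrC ler_pdivrMr ?mul1r ?lerDl// ltr_wpDl.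
Qed.

(** The derivative of the integral is the integral of [m t], since [B]
    dominates [m]; the same bound lets [t] go to infinity under the integral
    sign.  The values at the integers suffice because the limit [L] is known to
    exist. *)
Lemma cvg_derive_integral d (T : measurableType d) (P : probability T R)
    (f m : R -> T -> R) (g : T -> R) (B L : R) :
  (forall t : R, 0 < t -> measurable_fun setT (f t)) ->
  (forall t, measurable_fun setT (m t)) ->
  (forall (t : R) x, is_derive t 1 (f ^~ x) (m t x)) ->
  (forall x, f 0 x = 0) ->
  (forall t x, `|m t x| <= B) ->
  (forall x, m t x @[t --> +oo] --> g x) ->
  derive1 (fun t => \int[P]_x f t x) t @[t --> +oo] --> L ->
  measurable_fun setT g /\ L%:E = (\int[P]_x (g x)%:E)%E.
Proof.
move=> mf mm df f0 mB mg dL.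
have B0 : 0 <= B by exact: le_trans (normr_ge0 _) (mB 0 point).
have Pfin : (P setT < +oo)%E by rewrite probability_setT ltry.
have intf (t : R) : 0 < t -> P.-integrable setT (EFin \o f t).
  move=> t0; apply: measurable_bounded_integrable => //; first exact: mf.
  (* the mean value bound, as [f] vanishes at time 0 *)
  exists (B * t); split; first exact: num_real.
  move=> b /ltW bt x _ /=; apply: le_trans bt.
  exact: (primitive_norm_le (ltW t0) (fun s => df s x)).
have intB : P.-integrable setT (EFin \o cst B).
  exact: finite_measure_integrable_cst.
have dE (t : R) : 0 < t -> derive1 (fun t => \int[P]_x f t x) t = \int[P]_x m t x.
  move=> t0.
  have It : [set` `]0, t + 1[] t by rewrite /= in_itv /= t0 ltrDl ltr01.
  rewrite (@differentiation_under_integral _ _ _ P f setT measurableT t 0 (t + 1)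
    It _ _ (cst B) _ intB) //.
  - apply: eq_Rintegral => x _.
    by rewrite /partial1of2 derive1E; exact: derive_val.
  - move=> s; rewrite /= in_itv /= => /andP[s0 _]; exact: intf.
  - by move=> s x _ _; rewrite partial1of2E derive_val.
have cvgn (F : R -> R) (l : R) : F t @[t --> +oo] --> l ->
    F n%:R @[n --> \oo] --> l.
  by move=> Fl; apply: (cvg_comp _ _ (@cvgr_idn R)).
have mgn x : (m n%:R x)%:E @[n --> \oo] --> (g x)%:E.
  by apply: cvg_EFin; [exact: nearW|exact: cvgn (mg x)].
have mg' : measurable_fun setT g.
  apply: (@measurable_fun_cvg _ _ _ setT (fun n => m n%:R)) => // x _.
  exact: cvgn (mg x).
have [_ _ cint] : [/\ P.-integrable setT (EFin \o g),
    (\int[P]_x `|(m n%:R x)%:E - (g x)%:E|)%E @[n --> \oo] --> (0 : \bar R) &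
    (\int[P]_x (m n%:R x)%:E)%E @[n --> \oo] --> (\int[P]_x (g x)%:E)%E].
  apply: (@dominated_convergence _ T R P setT measurableT
    (fun n x => (m n%:R x)%:E) (EFin \o g) (EFin \o cst B)) => //.
  - by move=> n; exact/measurable_EFinP.
  - exact/measurable_EFinP.
  - by apply: aeW => x _.
  - by apply: aeW => x n _; rewrite lee_fin.
split => //.
have Ln : (\int[P]_x (m n%:R x)%:E)%E @[n --> \oo] --> L%:E.
  have : (\int[P]_x (m n%:R x))%:E @[n --> \oo] --> L%:E.
    apply: cvg_EFin; first exact: nearW.
    have := cvgn _ _ dL; apply: cvg_trans; apply: near_eq_cvg.
    near=> n; apply: dE; rewrite ltr0n; near: n; exact: nbhs_infty_gt.
  apply: cvg_trans; apply: near_eq_cvg; apply: nearW => n /=.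
  rewrite /Rintegral fineK//; apply: integrable_fin_num => //.
  apply: measurable_bounded_integrable => //.
  by exists B; split; [exact: num_real|move=> b /ltW Bb x _ /=; exact: le_trans Bb].
exact: cvg_unique Ln cint.
Unshelve. all: by end_near. Qed.

Lemma integral_finite_image d (T : measurableType d) (P : probability T R)
    (g : T -> R) (I : finType) (c : I -> R) :
  measurable_fun setT g -> injective c -> (forall x, exists i, g x = c i) ->
  (\int[P]_x (g x)%:E = \sum_(i : I) (c i)%:E * P (g @^-1` [set c i]))%E.
Proof.
move=> mg cI gc.
have mW i : measurable (g @^-1` [set c i]).
  by rewrite -[X in measurable X]setTI; exact: mg.
have gE x : ((g x)%:E = \sum_(i : I) (c i)%:E * (\1_(g @^-1` [set c i]) x)%:E)%E.
  have [j gj] := gc x.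
  rewrite (bigD1 j)//= big1 => [|i ij].
    by rewrite indicE mem_set//= mule1 adde0 gj.
  rewrite indicE memNset ?mule0//= gj => /cI ji.
  by rewrite ji eqxx in ij.
under eq_integral do rewrite gE.
rewrite integral_sum//; last first.
  move=> i; apply: integrableZl => //; exact: integrable_indic.
apply: eq_bigr => i _; rewrite integralZl//; last exact: integrable_indic.
by rewrite integral_indic// setIT.
Qed.

End ParametricPrimitives.

Lemma continuous_borel_measurable (R : realType) (T : ptopologicalType)
  (f : T -> R) : continuous f -> measurable_fun [set: borel T] (f : borel T -> R).
Proof.
move=> /continuousP cf; apply: (measurability _ (RGenOpens.measurableE R)).
move=> _ [_ [x [y ->] <-]]; apply: sub_sigma_algebra.
by rewrite /= setTI; exact/cf/interval_open.
Qed.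

(** * One-parameter subgroups and their flows *)

Section Groups.
Context {R : realType} {n : nat} (G : lie_group R n).
Implicit Types x y z : G.

Lemma lg_mulVr x : lg_mul x (lg_inv x) = lg_one G.
Proof.
by rewrite -[LHS]lg_mul1 -{1}(lg_mulV (lg_inv x)) -lg_mulA (lg_mulA (lg_inv x))
  lg_mulV lg_mul1 lg_mulV.
Qed.

Lemma lg_mulr1 x : lg_mul x (lg_one G) = x.
Proof. by rewrite -(lg_mulV x) lg_mulA lg_mulVr lg_mul1. Qed.

Lemma lg_inv_uniq x y : lg_mul x y = lg_one G -> lg_inv x = y.
Proof. by move=> xy; rewrite -[LHS]lg_mulr1 -xy lg_mulA lg_mulV lg_mul1. Qed.

Lemma lg_idem x : lg_mul x x = x -> x = lg_one G.
Proof. by move=> xx; rewrite -(lg_mulV x) -{3}xx lg_mulA lg_mulV lg_mul1. Qed.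

Variables (e : 'rV[R]_n -> G) (He : exponential e).

Lemma exp0 : e 0 = lg_one G.
Proof.
have [_ eD _] := He 0; apply: lg_idem.
by have := eD 0 0; rewrite addr0 scale0r.
Qed.

Lemma expD s t w : e ((s + t) *: w) = lg_mul (e (s *: w)) (e (t *: w)).
Proof. by have [_ eD _] := He w. Qed.

Lemma expNV t w : lg_mul (e (- t *: w)) (e (t *: w)) = lg_one G.
Proof. by rewrite -expD addNr scale0r exp0. Qed.

End Groups.

Section Flow.
Context {R : realType} {n d : nat} (M : manifold R n)
  (G : lie_group R d) (e : 'rV[R]_d -> G) (He : exponential e)
  (a : G -> M -> M) (Ha : smooth_action a) (w : 'rV[R]_d).

Let phi t x := a (e (t *: w)) x.

Lemma flow_continuous : continuous (fun z : R * M => a (e (z.1 *: w)) z.2).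
Proof.
have [[ca _] _ _] := Ha; have [[ce _] _ _] := He w.
move=> [t x].
apply: (@cvg_comp _ _ _ (fun z : R * M => (e (z.1 *: w), z.2))
  (fun z : G * M => a z.1 z.2) _ (nbhs (e (t *: w), x))); last exact: ca (_, _).
apply: (cvg_pair _ cvg_snd).
by apply: (@cvg_comp _ _ _ fst (fun t => e (t *: w)) _ (nbhs t));
  [exact: cvg_fst|exact: ce].
Qed.

Lemma flow_add s t x : phi (s + t) x = phi s (phi t x).
Proof. by rewrite /phi expD//; case: Ha. Qed.

(** [phi s (phi t x) = phi (s + t) x] tends to both [phi s y] and [y]. *)
Lemma flow_limit_fixed x y : phi t x @[t --> +oo] --> y ->
  forall s, phi s y = y.
Proof.
move=> xy s.
have h1 : phi s (phi t x) @[t --> +oo] --> phi s y.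
  apply: (@cvg_comp _ _ _ (fun t => phi t x) (phi s) _ (nbhs y)) => //.
  apply: (@cvg_comp _ _ _ (fun z => (s, z)) (fun z : R * M => phi z.1 z.2) _
    (nbhs (s, y))); last exact: flow_continuous (s, y).
  exact: (cvg_pair (cvg_cst _) cvg_id).
have h2 : phi s (phi t x) @[t --> +oo] --> y.
  under eq_fun do rewrite -flow_add.
  apply: (cvg_comp (fun t => s + t) (fun t => phi t x) _ xy).
  exact: cvg_addrl.
exact: (cvg_unique (@manifold_hausdorff _ _ M) h1 h2).
Qed.

(** The fundamental vector is the velocity at time [0] of a trajectory, which
    is constant here. *)
Lemma fixed_fundamental0 y : smooth_map (fun g => a g y) ->
  (forall s, phi s y = y) -> fundamental a w y = 0.
Proof.
move=> sa fy; have [sc _ ve] := He w.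
have e0 : e (0 *: w) = lg_one G by rewrite scale0r exp0.
have := velocity_comp 0 sa sc; rewrite ve e0 /fundamental => <-.
rewrite /velocity /=.
rewrite [X in derive1 X _](_ : _ = cst (chart_at y y)); first exact: derive1_cst.
by apply/funext => t /=; rewrite -!/(phi _ _) !fy.
Qed.

End Flow.

(** * Momentum maps and Kempf-Ness functions *)

Lemma inner_product0l (R : realType) n (b : 'rV[R]_n -> 'rV[R]_n -> R) z :
  inner_product b -> b 0 z = 0.
Proof.
move=> [lin _ _]; have /eqP := lin 1 0 0 z.
by rewrite scale1r addr0 mul1r -subr_eq subrr => /eqP.
Qed.

Lemma complex_structure0 (R : realType) n (M : manifold R n)
  (J : M -> 'rV[R]_n -> 'rV[R]_n) p : complex_structure J -> J p 0 = 0.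
Proof.
move=> cJ; have := cs_linear cJ p (-1) 0 0.
by rewrite scaler0 addr0 scaleN1r addNr.
Qed.

Lemma itimesN (R : realType) k d (K : lie_group R k)
    (G : complex_lie_group R d) (iota : K -> G) (v : 'rV[R]_k) :
  itimes iota (- v) = - itimes iota v.
Proof.
rewrite /itimes /tmap raddfN.
set u := 'd _ _ v; have := cs_linear (clg_complex G) (lg_one G) (-1) u 0.
by rewrite (complex_structure0 _ (clg_complex G)) !scaleN1r !addr0.
Qed.

(** At the limit point [y] the fundamental vector of [iv] vanishes; it is [J]
    applied to that of [v], and it represents [d mu^v] up to the metric. *)
Lemma flow_limit_critical (R : realType) (n k d : nat) (M : manifold R n)
    (J : M -> 'rV[R]_n -> 'rV[R]_n) (gM : M -> 'rV[R]_n -> 'rV[R]_n -> R)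
    (K : lie_group R k) (aK : K -> M -> M) (mu : M -> {scalar 'rV[R]_k})
    (G : complex_lie_group R d) (iota : K -> G) (e : 'rV[R]_d -> G)
    (aG : G -> M -> M) (v : 'rV[R]_k) (x y : M) :
  riemannian_metric gM -> momentum_map J gM aK mu -> exponential e ->
  complexified_action J aK iota aG ->
  aG (e (t *: itimes iota v)) x @[t --> (+oo : set_system R)] --> y ->
  critical_value (fun x => mu x v) (mu y v).
Proof.
move=> [ip _] mm He ca xy; exists y => // Y.
rewrite (mm_diff mm) /kahler_form.
have fy0 : fundamental aG (itimes iota v) y = 0.
  apply: (fixed_fundamental0 He).
    by have [] := ca_holomorphic_l ca y.
  exact: (flow_limit_fixed He (ca_action ca) xy).
have -> : J y (fundamental aK v y) = 0 by rewrite -(ca_fundamental ca).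
exact: inner_product0l.
Qed.

Section KempfNess.
Context {R : realType} {n k d : nat} (M : manifold R n) (K : lie_group R k)
  (G : complex_lie_group R d) (iota : K -> G) (e : 'rV[R]_d -> G)
  (He : exponential e) (a : G -> M -> M) (Ha : smooth_action a)
  (mu : M -> {scalar 'rV[R]_k}) (Psi : M -> G -> R)
  (kn : kempf_ness iota e a mu Psi).

Lemma kempf_ness_one x : Psi x (lg_one G) = 0.
Proof.
have [_ a1 _] := Ha; have := kn_cocycle kn x (lg_one G) (lg_one G).
by rewrite a1 lg_mul1 => /(canRL (addrK _)); rewrite subrr.
Qed.

(** The cocycle identity makes the increments of [Psi x] along the flow from
    time [t] the increments of [Psi (phi t x)] from time [0]. *)
Lemma kempf_ness_is_derive v x (t : R) :
  is_derive t 1 (fun s : R => Psi x (e (s *: itimes iota v)))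
    (mu (a (e (t *: itimes iota v)) x) v).
Proof.
have [sc _ _] := He (itimes iota v).
apply: DeriveDef; first exact: (smooth_fun_curve_derivable (kn_smooth kn x) sc).
rewrite -derive1E -(kn_derive kn) /derive1.
congr (lim _); apply: (congr1 (fun F => F @ 0^')); apply/funext => h /=; congr (_ *: _).
rewrite addr0 scale0r (exp0 He) kempf_ness_one subr0 (expD He).
by rewrite -(kn_cocycle kn) addrC addKr.
Qed.

End KempfNess.

(** The chosen representative of [g K] is [g z^-1] with [z] in [K], so its
    inverse is [z g^-1], and [Psi] does not see [z]. *)
Lemma psiX_coset (R : realType) (n k d l : nat) (M : manifold R n)
    (K : lie_group R k) (G : complex_lie_group R d) (iota : K -> G)
    (X : manifold R l) (pi : G -> X) (Psi : M -> G -> R)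
    (nu : probability (borel M) R) (g : G) :
  (forall g h, pi g = pi h <-> exists z, h = lg_mul g (iota z)) ->
  (forall x z g, Psi x (lg_mul (iota z) g) = Psi x g) ->
  psiX pi Psi nu (pi g) = PsiP Psi nu (lg_inv g).
Proof.
move=> fiber inv; rewrite /psiX /PsiP; set h := get _.
have hE : pi h = pi g by apply: (@getPex _ [set h | pi h = pi g]); exists g.
have [z gE] := (fiber _ _).1 hE.
have -> : lg_inv h = lg_mul (iota z) (lg_inv g).
  by apply: lg_inv_uniq; rewrite lg_mulA -gE lg_mulVr.
by apply: eq_Rintegral => x _; rewrite inv.
Qed.

(** * The maximal weight *)

Theorem theorem5p23 (R : realType) (n k d l : nat)
  (* the compact Kaehler manifold M *)
  (M : manifold R n)
  (J : M -> 'rV[R]_n -> 'rV[R]_n)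
  (gM : M -> 'rV[R]_n -> 'rV[R]_n -> R)
  (M_compact : compact [set: M])
  (M_kahler : kahler J gM)
  (* the compact connected group K, its Hamiltonian action, and G = K^C *)
  (K : lie_group R k)
  (K_compact : compact [set: K])
  (K_connected : connected [set: K])
  (aK : K -> M -> M)
  (mu : M -> {scalar 'rV[R]_k})
  (aK_hamiltonian : hamiltonian_action J gM aK mu)
  (G : complex_lie_group R d)
  (iota : K -> G)
  (G_complexification : complexification iota)
  (expG : 'rV[R]_d -> G)
  (expG_exponential : exponential expG)
  (aG : G -> M -> M)
  (aG_action : complexified_action J aK iota aG)
  (flow_converges : forall (x : M) (v : 'rV[R]_k),
    cvg (aG (expG (t *: itimes iota v)) x @[t --> (+oo : set_system R)]))
  (* the symmetric space X = G/K *)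
  (sp : 'rV[R]_k -> 'rV[R]_k -> R)
  (sp_inner : inner_product sp)
  (sp_Ad : forall (z : K) (v w : 'rV[R]_k), sp (Ad z v) (Ad z w) = sp v w)
  (X : manifold R l)
  (pi : G -> X)
  (aX : G -> X -> X)
  (gX : X -> 'rV[R]_l -> 'rV[R]_l -> R)
  (X_symmetric : symmetric_space iota sp pi aX gX)
  (ray_geodesic : forall v : 'rV[R]_k, sp v v = 1 ->
    unit_speed_geodesic gX (ray iota expG pi v))
  (* the Kempf-Ness function *)
  (Psi : M -> G -> R)
  (Psi_kempf_ness : kempf_ness iota expG aG mu Psi)
  (* the measure and its maximal weight *)
  (nu : probability (borel M) R)
  (lam : tits_boundary gX -> R)
  (lam_weight : maximal_weight pi Psi nu lam)
  (v : 'rV[R]_k)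
  (v_unit : sp v v = 1)
  (* the critical values c_0 < ... < c_r *)
  (r : nat)
  (c : 'I_r.+1 -> R)
  (c_increasing : forall i j : 'I_r.+1, (i < j)%N -> c i < c j)
  (c_critical : forall a : R,
    critical_value (fun x : M => mu x v) a <-> exists i, c i = a) :
  let C (i : 'I_r.+1) : set M := (fun x : M => mu x v) @^-1` [set c i] in
  let Wu (i : 'I_r.+1) : set M :=
    [set x | C i (lim (aG (expG (t *: itimes iota v)) x
                         @[t --> (+oo : set_system R)]))] in
  (lam (boundary_class (ray_geodesic (- v) (unit_opp sp_inner v_unit))))%:E
  = (\sum_(i < r.+1) (c i)%:E * nu (Wu i))%E.
Proof.
move=> C Wu.
set w := itimes iota v.
pose phi (t : R) x := aG (expG (t *: w)) x.
pose m (t : R) x := mu (phi t x) v.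
pose f (t : R) x := Psi x (expG (t *: w)).
pose y x := lim (phi t x @[t --> +oo]).
pose g x := mu (y x) v.
have aGa := ca_action aG_action.
have mm := ha_momentum aK_hamiltonian.
have cmu : continuous (fun x => mu x v) := smooth_fun_continuous (mm_smooth mm v).
have cphi : continuous (fun z : R * M => phi z.1 z.2) :=
  flow_continuous expG_exponential aGa (w := w).
have cm : continuous (fun z : R * M => m z.1 z.2).
  by move=> z; exact: (cvg_comp _ _ (cphi z) (cmu _)).
have cmt t : continuous (m t).
  move=> x; apply: (@cvg_comp _ _ _ (fun x => (t, x)) (fun z : R * M => m z.1 z.2)
    _ (nbhs (t, x))); last exact: cm (t, x).
  exact: (cvg_pair (cvg_cst _) cvg_id).
have [B mB] : exists B, forall x, `|mu x v| <= B.
  have : compact ((fun x => mu x v) @` [set: M]).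
    by apply: continuous_compact => //; exact: continuous_subspaceT.
  move=> /compact_bounded[B [_ hB]]; exists (B + 1) => x.
  by apply: hB; [rewrite ltrDl|exists x].
have df (t : R) x : is_derive t 1 (f ^~ x) (m t x).
  exact: (kempf_ness_is_derive expG_exponential aGa Psi_kempf_ness).
have f0 x : f 0 x = 0.
  rewrite /f scale0r (exp0 expG_exponential).
  exact: (kempf_ness_one aGa Psi_kempf_ness).
have phiy x : phi t x @[t --> +oo] --> y x := flow_converges x v.
have mg x : m t x @[t --> +oo] --> g x.
  exact: (cvg_comp _ _ (phiy x) (cmu (y x))).
have gc x : exists i, g x = c i.
  have [|i ci] := (c_critical (g x)).1; last by exists i.
  exact: (flow_limit_critical (kahler_metric M_kahler) mm expG_exponential
    aG_action (phiy x)).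
(* [e(-v)] is the class of the ray of [- v], and the inverse in [psi] turns
   [exp(-itv)] back into [exp(itv)]. *)
have psiE : psiX pi Psi nu \o ray iota expG pi (- v) =
    (fun t => \int[nu]_x f t x).
  apply/funext => t /=; rewrite /ray itimesN scalerN -scaleNr.
  rewrite (psiX_coset _ _ (ss_fiber X_symmetric) (kn_invariant Psi_kempf_ness)).
  by rewrite (lg_inv_uniq (expNV expG_exponential _ _)).
have dL := lam_weight _ (ray_geodesic (- v) (unit_opp sp_inner v_unit)).
rewrite psiE in dL.
have mf (t : R) : 0 < t -> measurable_fun [set: borel M] (f t : borel M -> R).
  move=> t0; apply: continuous_borel_measurable.
  exact: (primitive_continuous (ltW t0) df f0 cm).
have mmb t : measurable_fun [set: borel M] (m t : borel M -> R).
  exact: continuous_borel_measurable.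
have [mg' lamE] := @cvg_derive_integral R _ (borel M) nu f m g B _ mf mmb df f0
  (fun t x => mB _) mg dL.
have cI : injective c.
  move=> i j cij; case: (ltngtP i j) => [/c_increasing|/c_increasing|/ord_inj//].
    by rewrite cij ltxx.
  by rewrite cij ltxx.
refine (etrans lamE _).
exact: (@integral_finite_image R _ (borel M) nu g _ c mg' cI gc).
Qed.
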